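(* Let $N$ be an odd perfect number given in Eulerian form $N = q^k n^2$ (with Euler prime $q$). If $n < q$, then $k = 1$.
   Context: $\sigma(x)=\sum_{d\mid x} d$ denotes the sum of the positive divisors of the positive integer $x$. A positive integer $N$ is perfect if $\sigma(N) = 2N$. An odd perfect number $N$ is said to be given in Eulerian form if $N = q^k n^2$ where $q$ is a prime (called the Euler prime of $N$), $k$ and $n$ are positive integers, $q \equiv k \equiv 1 \pmod 4$ and $\gcd(q,n)=1$. *)

(* Defs.v *)
From mathcomp Require Import all_boot.

Set Implicit Arguments.
Unset Strict Implicit.
Unset Printing Implicit Defensive.

(* Only meaningful for x > 0: [divisors 0] is [:: 1]. *)
Definition sigma (x : nat) : nat := \sum_(d <- divisors x) d.

Definition perfect (N : nat) : Prop := 0 < N /\ sigma N = 2 * N.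

Definition eulerian_form (N q k n : nat) : Prop :=
  [/\ N = q ^ k * n ^ 2,
      prime q,
      0 < k /\ 0 < n,
      q = 1 %[mod 4] /\ k = 1 %[mod 4]
    & gcdn q n = 1].

(* Main.v *)
Require Import Defs.
From mathcomp Require Import all_boot.

(** Write [N = q ^ k * n ^ 2] with coprime factors.  Since [sigma] is
multiplicative ([sigma_coprime]), perfection reads
[sigma (q ^ k) * sigma (n ^ 2) = 2 * q ^ k * n ^ 2].  Every divisor of [q ^ k]
other than [1] is a multiple of [q], so [sigma (q ^ k)] is prime to [q]
([coprime_sigma_pexp]), and therefore [q ^ k] divides [sigma (n ^ 2)].  On the
other hand [q ^ k <= sigma (q ^ k)], so the same equation bounds
[sigma (n ^ 2)] by [2 * n ^ 2].  Together with [n < q] this gives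
[q ^ k <= 2 * n ^ 2 < 2 * q ^ 2 <= q ^ 3], hence [k < 3], and the congruence
[k = 1 %[mod 4]] leaves only [k = 1]. *)

(** For coprime [a] and [b], the map [d |-> (gcdn d a, gcdn d b)] inverts
[(x, y) |-> x * y] between divisors of [a * b] and pairs of divisors. *)
Lemma perm_divisors_coprime a b : 0 < a -> 0 < b -> coprime a b ->
  perm_eq (divisors (a * b)) [seq x * y | x <- divisors a, y <- divisors b].
Proof.
move=> a_gt0 b_gt0 co_ab; apply: uniq_perm; first exact: divisors_uniq.
  apply: allpairs_uniq; [exact: divisors_uniq | exact: divisors_uniq |].
  have gcd_recover x y : x %| a -> y %| b ->
      gcdn (x * y) a = x /\ gcdn (x * y) b = y.
    move=> xa yb; split.
      rewrite gcdnC Gauss_gcdl; first exact/gcdn_idPr.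
      exact: coprime_dvdr yb co_ab.
    rewrite gcdnC Gauss_gcdr; first exact/gcdn_idPr.
    by rewrite coprime_sym; apply: coprime_dvdl xa co_ab.
  move=> u v /allpairsP[[x y] /= [xa yb ->]].
  move=> /allpairsP[[x' y'] /= [xa' yb' ->]] /= eq_xy.
  rewrite -!dvdn_divisors // in xa yb xa' yb'.
  have [] := gcd_recover x y xa yb; rewrite eq_xy.
  by have [-> ->] := gcd_recover x' y' xa' yb' => -> ->.
move=> d; rewrite -dvdn_divisors ?muln_gt0 ?a_gt0 //.
apply/idP/allpairsP => [d_ab | [[x y] /= [xa yb ->]]]; last first.
  by rewrite -!dvdn_divisors // in xa yb; apply: dvdn_mul.
exists (gcdn d a, gcdn d b); rewrite /= -!dvdn_divisors // !dvdn_gcdr.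
split=> //; apply/eqP; rewrite eqn_dvd; apply/andP; split.
  rewrite muln_gcdl dvdn_gcd dvdn_mulr //= muln_gcdr dvdn_gcd d_ab andbT.
  exact: dvdn_mull.
rewrite Gauss_dvd ?dvdn_gcdl //.
exact: coprime_dvdl (dvdn_gcdr _ _) (coprime_dvdr (dvdn_gcdr _ _) co_ab).
Qed.

Lemma sigma_coprime a b : 0 < a -> 0 < b -> coprime a b ->
  sigma (a * b) = sigma a * sigma b.
Proof.
move=> a_gt0 b_gt0 co_ab; rewrite /sigma.
rewrite (perm_big _ (perm_divisors_coprime _ _ a_gt0 b_gt0 co_ab)) /=.
rewrite big_allpairs_dep big_distrl /=.
by apply: eq_bigr => x _; rewrite big_distrr.
Qed.

Lemma leq_sigma a : 0 < a -> a <= sigma a.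
Proof.
move=> a_gt0; rewrite /sigma (bigD1_seq a) ?divisors_uniq ?leq_addr //.
by rewrite -dvdn_divisors.
Qed.

(** All divisors of [p ^ k] except [1] vanish modulo [p], so
[sigma (p ^ k)] is [1] modulo [p]. *)
Lemma coprime_sigma_pexp p k : prime p -> coprime p (sigma (p ^ k)).
Proof.
move=> p_pr; have pk_gt0 : 0 < p ^ k by rewrite expn_gt0 prime_gt0.
rewrite prime_coprime // /sigma (bigD1_seq 1) ?divisors_uniq //=; last first.
  by rewrite -dvdn_divisors.
rewrite dvdn_addl ?Euclid_dvd1 // big_seq_cond.
apply: (big_ind (dvdn p)) => [||d /andP[]]; [exact: dvdn0 | exact: dvdn_add |].
rewrite -dvdn_divisors // => /(dvdn_pfactor _ _ p_pr)[[|i] _ ->] //.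
by rewrite expnS dvdn_mulr.
Qed.

Theorem lemma3p1 (N q k n : nat) (N_odd : odd N) (N_perfect : perfect N)
  (N_euler : eulerian_form N q k n) (lt_nq : n < q) : k = 1.
Proof.
case: N_euler => -> q_pr [k_gt0 n_gt0] [_ k_mod4] co_qn in N_perfect.
case: N_perfect => _ sigma_N.
have q_gt1 := prime_gt1 q_pr.
have qk_gt0 : 0 < q ^ k by rewrite expn_gt0 prime_gt0.
have n2_gt0 : 0 < n ^ 2 by rewrite expn_gt0 n_gt0.
have co_qk_n2 : coprime (q ^ k) (n ^ 2).
  by rewrite coprimeXl // coprimeXr // /coprime co_qn.
rewrite sigma_coprime // in sigma_N.
have qk_dvd : q ^ k %| sigma (n ^ 2).
  rewrite -(@Gauss_dvdr _ (sigma (q ^ k))) ?coprimeXl ?coprime_sigma_pexp //.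
  by rewrite sigma_N mulnCA dvdn_mulr.
have sigma_n2_le : sigma (n ^ 2) <= 2 * n ^ 2.
  rewrite -(leq_pmul2l qk_gt0) mulnCA -sigma_N.
  by rewrite leq_mul2r leq_sigma ?orbT.
have qk_le : q ^ k <= 2 * n ^ 2.
  apply: leq_trans sigma_n2_le; apply: dvdn_leq qk_dvd.
  exact: leq_trans n2_gt0 (leq_sigma _ n2_gt0).
have qk_lt : q ^ k < q ^ 3.
  apply: leq_ltn_trans qk_le _; rewrite (expnS q 2).
  apply: (@leq_trans (2 * q ^ 2)); last by rewrite leq_mul2r q_gt1 orbT.
  by rewrite ltn_pmul2l // ltn_exp2r.
move: qk_lt; rewrite ltn_exp2l // => k_lt3.
by case: k k_gt0 k_mod4 k_lt3 {qk_dvd qk_le co_qk_n2 qk_gt0 sigma_N} => [|[|[|]]].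
Qed.
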